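(* Let $K \subset \mathbb{R}^m$ be a full-dimensional closed convex cone and let $C \subset \mathbb{R}^n$ be a convex body (compact, convex, with the origin in its interior). If $C$ has a proper $K$-lift, then the slack operator $S_C$ is $K$-factorizable. Conversely, if $S_C$ is $K$-factorizable, then $C$ has a $K$-lift.
   Context: The polar of $C$ is $C^\circ = \{y \in \mathbb{R}^n : \langle x,y\rangle \le 1 \ \forall x \in C\}$. $\mathrm{ext}(C)$ denotes the set of extreme points of $C$. The dual cone is $K^* = \{y \in \mathbb{R}^m : \langle x,y\rangle \ge 0 \ \forall x \in K\}$. The slack operator $S_C : \mathrm{ext}(C) \times \mathrm{ext}(C^\circ) \to \mathbb{R}$ is $S_C(x,y) = 1 - \langle x,y\rangle$. A $K$-lift of $C$ is a set $Q = K \cap L$, where $L \subset \mathbb{R}^m$ is an affine subspace, together with a linear map $\pi : \mathbb{R}^m \to \mathbb{R}^n$ such that $C = \pi(Q)$. The lift is proper if $L$ intersects the interior of $K$. $S_C$ is $K$-factorizable if there exist maps (not necessarily linear) $A : \mathrm{ext}(C) \to K$ and $B : \mathrm{ext}(C^\circ) \to K^*$ such that $S_C(x,y) = \langle A(x), B(y)\rangle$ for all $(x,y) \in \mathrm{ext}(C) \times \mathrm{ext}(C^\circ)$. *)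

(* Defs.v *)
From HB Require Import structures.
From mathcomp Require Import all_boot all_order all_algebra.
From mathcomp Require Import all_classical all_reals all_analysis.

Set Implicit Arguments.
Unset Strict Implicit.
Unset Printing Implicit Defensive.

Import Order.TTheory GRing.Theory Num.Theory.
Import numFieldNormedType.Exports.

Local Open Scope classical_set_scope.
Local Open Scope ring_scope.

(* R^n is the type 'rV[R]_n of row vectors, with its product topology. *)

Section ConvexGeometry.
Variables (R : realType) (n : nat).
Local Notation V := 'rV[R]_n.

Definition dot (x y : V) : R := \sum_(i < n) x 0 i * y 0 i.

Definition ext (C : set V) : set V :=
  [set x | C x /\ forall a b (t : R), C a -> C b -> 0 < t < 1 ->
                    x = t *: a + (1 - t) *: b -> a = x /\ b = x].

Definition polar (C : set V) : set V :=
  [set y | forall x, C x -> dot x y <= 1].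

Definition dual_cone (K : set V) : set V :=
  [set y | forall x, K x -> 0 <= dot x y].

Definition affine_subspace (L : set V) : Prop :=
  L !=set0 /\ forall x y (t : R), L x -> L y -> L (t *: x + (1 - t) *: y).

Definition convex_cone (K : set V) : Prop :=
  [/\ K !=set0, convex_set K & forall x (t : R), 0 <= t -> K x -> K (t *: x)].

(* [smallest affine_subspace K] is the affine hull of K. *)
Definition full_dimensional (K : set V) : Prop :=
  smallest affine_subspace K = setT.

Definition convex_body (C : set V) : Prop :=
  [/\ compact C, convex_set C & C° 0].

(* The sets [ext C] and [ext (polar C)] are used as types here, so that the
   slack operator is only defined on ext(C) x ext(polar C). *)
Definition slack (C : set V) (x : ext C) (y : ext (polar C)) : R :=
  1 - dot (\val x) (\val y).

End ConvexGeometry.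

Section Lifts.
Variables (R : realType) (m n : nat).
Implicit Types (K L : set 'rV[R]_m) (C : set 'rV[R]_n).

Definition is_lift K C L (pi : {linear 'rV[R]_m -> 'rV[R]_n}) : Prop :=
  affine_subspace L /\ C = pi @` (K `&` L).

Definition has_lift K C : Prop := exists L pi, is_lift K C L pi.

Definition has_proper_lift K C : Prop :=
  exists L pi, is_lift K C L pi /\ (L `&` K°) !=set0.

Definition factorizable K C : Prop :=
  exists (A : ext C -> K) (B : ext (polar C) -> dual_cone K),
    forall (x : ext C) (y : ext (polar C)),
      slack x y = dot (\val (A x)) (\val (B y)).

End Lifts.

(* Main.v *)
Require Import Defs.
From HB Require Import structures.
From mathcomp Require Import all_boot all_order all_algebra.
From mathcomp Require Import all_classical all_reals all_analysis.
From mathcomp Require Import ring lra.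

(* Proper lift => factorization.  Let C = pi(K /\ L) and l in L interior to K.
   Since C is bounded and not a point, no direction of L is interior to K; in
   particular 0 is not in L.  Hence, for y in the polar of C, the affine
   function w |-> 1 - <pi w, y> on L is the restriction of a linear functional
   on span L, and it is nonnegative on K /\ span L.  By M. Riesz extension it
   extends to an element B(y) of the dual cone, while A(x) is any preimage of x
   in K /\ L.

   Factorization => lift.  The relation "1 - <x, y> = <z, B(y)> for all extreme
   points y of the polar" between z and x is the graph of an affine map on an
   affine subspace L, and is induced by a linear map pi.  By Minkowski's theorem
   for the polar and the bipolar theorem, pi(K /\ L) is contained in C; it
   contains pi(A(x)) = x for all extreme points x, hence C by Minkowski's
   theorem. *)

Set Implicit Arguments.
Unset Strict Implicit.
Unset Printing Implicit Defensive.

Import Order.TTheory GRing.Theory Num.Theory.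
Import numFieldNormedType.Exports.

Local Open Scope classical_set_scope.
Local Open Scope ring_scope.

(** * Linear subspaces and linear relations *)

Section LinearSubspaces.
Variable F : fieldType.

Definition linear_subspace (V : lmodType F) (M : set V) : Prop :=
  [/\ M 0, forall x y, M x -> M y -> M (x + y) &
      forall (t : F) x, M x -> M (t *: x)].

Lemma linear_subspace_sum (V : lmodType F) (M : set V) (I : Type) (r : seq I)
    (P : pred I) (f : I -> V) :
  linear_subspace M -> (forall i, P i -> M (f i)) ->
  M (\sum_(i <- r | P i) f i).
Proof. by move=> [M0 MD _] Mf; apply: big_ind. Qed.

(** Among matrices with rows in [M], one of maximal rank spans [M]: a vector of [M] outside its row
    space would raise the rank. *)
Lemma linear_subspace_rowspace m (M : set 'rV[F]_m) :
  linear_subspace M -> exists A : 'M[F]_m, forall w, M w <-> (w <= A)%MS.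
Proof.
move=> subM; have [M0 MD MZ] := subM.
pose P k := `[< exists A : 'M[F]_m, (forall i, M (row i A)) /\ \rank A = k >].
have exP : exists k, P k.
  by exists 0%N; apply/asboolP; exists 0; split=> [i|]; rewrite ?row0 ?mxrank0.
have ubP k : P k -> (k <= m)%N.
  by move=> /asboolP[A [_ <-]]; exact: rank_leq_row.
case: (ex_maxnP exP ubP) => k /asboolP[A [MA rkA]] maxk.
have MsubA B w : (forall i, M (row i B)) -> (w <= B)%MS -> M w.
  move=> MB /submxP[c ->]; rewrite mulmx_sum_row.
  by apply: linear_subspace_sum => // i _; exact: MZ.
exists A => w; split=> [Mw|]; last exact: MsubA.
apply: contrapT => /negP nwA.
have /maxk : P (\rank (A + w)%MS).
  apply/asboolP; exists (A + w)%MS; split=> // i.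
  have /sub_addsmxP[[u v] /= ->] := row_sub i (A + w)%MS.
  apply: MD; first by apply: (MsubA _ A); rewrite ?submxMl.
  by rewrite (mx11_scalar v) mul_scalar_mx; exact: MZ.
by rewrite -rkA leqNgt rank_ltmx// ltmxE addsmxSl addsmx_sub submx_refl.
Qed.

(** The graph is the row space of some [[P Q]], that is, all pairs [(c P, c Q)]. A pseudo-inverse of
    [P] recovers [c] from [z = c P] up to the kernel of [P], and [G0] says that [Q] vanishes on this
    kernel. *)
Lemma linear_graph_extension m n (G : 'rV[F]_m -> 'rV[F]_n -> Prop) :
  linear_subspace [set w : 'rV_(m + n) | G (lsubmx w) (rsubmx w)] ->
  (forall x, G 0 x -> x = 0) ->
  exists pi : {linear 'rV[F]_m -> 'rV[F]_n}, forall z x, G z x -> pi z = x.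
Proof.
move=> /linear_subspace_rowspace[A GA] G0.
set P := lsubmx A; set Q := rsubmx A.
have GPQ (c : 'rV_(m + n)) : G (c *m P) (c *m Q).
  by rewrite mulmx_lsub mulmx_rsub; apply/GA; exact: submxMl.
exists (mulmxr (pinvmx P *m Q)) => z x Gzx /=.
have /submxP[c zxE] : (row_mx z x <= A)%MS.
  by apply/GA; rewrite /= row_mxKl row_mxKr.
have -> : z = c *m P by rewrite mulmx_lsub -zxE row_mxKl.
have -> : x = c *m Q by rewrite mulmx_rsub -zxE row_mxKr.
apply/eqP; rewrite -subr_eq0 [_ *m (_ *m Q)]mulmxA -mulmxBl; apply/eqP/G0.
have <- : (c *m P *m pinvmx P - c) *m P = 0.
  by rewrite mulmxBl mulmxKpV ?subrr ?submxMl.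
exact: GPQ.
Qed.

End LinearSubspaces.

(** * The inner product and orthogonality *)

Section Dot.
Variables (R : realType) (n : nat).
Implicit Types x y z : 'rV[R]_n.

Lemma dotE x y : dot x y = (x *m y^T) 0 0.
Proof. by rewrite mxE; apply: eq_bigr => i _; rewrite mxE. Qed.

Lemma dotC x y : dot x y = dot y x.
Proof. by apply: eq_bigr => i _; rewrite mulrC. Qed.

Lemma dotDl x y z : dot (x + y) z = dot x z + dot y z.
Proof. by rewrite !dotE mulmxDl mxE. Qed.

Lemma dotZl t x z : dot (t *: x) z = t * dot x z.
Proof. by rewrite !dotE -scalemxAl mxE. Qed.

Lemma dotDr x y z : dot x (y + z) = dot x y + dot x z.
Proof. by rewrite -!(dotC _ x) ?dotDl// dotC dotDl !(dotC x). Qed.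

Lemma dotZr t x z : dot x (t *: z) = t * dot x z.
Proof. by rewrite dotC dotZl dotC. Qed.

Lemma dotNl x y : dot (- x) y = - dot x y.
Proof. by rewrite -scaleN1r dotZl mulN1r. Qed.

Lemma dotNr x y : dot x (- y) = - dot x y.
Proof. by rewrite dotC dotNl dotC. Qed.

Lemma dot0l x : dot 0 x = 0.
Proof. by rewrite dotE mul0mx mxE. Qed.

Lemma dot0r x : dot x 0 = 0.
Proof. by rewrite dotC dot0l. Qed.

Definition dot_lin := (dotDl, dotDr, dotZl, dotZr, dotNl, dotNr, dot0l, dot0r).

Lemma dot_ge0 x : 0 <= dot x x.
Proof. by apply: sumr_ge0 => i _; rewrite -expr2 sqr_ge0. Qed.

Lemma dot_eq0 x : dot x x = 0 -> x = 0.
Proof.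
move=> /eqP; rewrite psumr_eq0; last by move=> i _; rewrite -expr2 sqr_ge0.
move=> /allP x0; apply/rowP => i; apply/eqP; rewrite mxE.
by have := x0 i (mem_index_enum i); rewrite mulf_eq0 orbb.
Qed.

Lemma dot_gt0 x : x != 0 -> 0 < dot x x.
Proof.
move=> x0; rewrite lt_neqAle dot_ge0 andbT eq_sym.
by apply: contra_neq x0 => /dot_eq0.
Qed.

Lemma continuous_dot x : continuous (dot x).
Proof.
apply: continuous_big => [|i _ y]; first exact: add_continuous.
apply: (@continuousM _ _ (fun=> x 0 i) (fun y : 'rV_n => y 0 i)).
  exact: cst_continuous.
exact: coord_continuous.
Qed.

Lemma continuous_dist2 x : continuous (fun y => dot (x - y) (x - y)).
Proof.
have cB i : continuous (fun y : 'rV_n => (x - y) 0 i).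
  move=> y; apply: (@continuous_comp _ _ _ (fun y : 'rV_n => x - y)
    (fun z : 'rV_n => z 0 i)); last exact: coord_continuous.
  by apply: (@continuousB _ _ _ (fun=> x) id) => //; exact: cst_continuous.
apply: continuous_big => [|i _ y]; first exact: add_continuous.
by apply: (@continuousM _ _ (fun y : 'rV_n => (x - y) 0 i)); exact: cB.
Qed.

(** The columns of the cokernel matrix serve as normal vectors. Having finitely many equations
    allows induction on their number in the Riesz extension. *)
Lemma linear_subspace_orth (M : set 'rV[R]_n) : linear_subspace M ->
  exists us : seq 'rV[R]_n, forall w, M w <-> {in us, forall u, dot w u = 0}.
Proof.
move=> /linear_subspace_rowspace[A MA].
exists [seq (col j (cokermx A))^T | j <- enum 'I_n] => w; rewrite MA submxE.
have dotj j : dot w (col j (cokermx A))^T = (w *m cokermx A) 0 j.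
  by rewrite dotE trmxK !mxE; apply: eq_bigr => i _; rewrite mxE.
split=> [/eqP w0 _ /mapP[j _ ->]|w0]; first by rewrite dotj w0 mxE.
apply/eqP/rowP => j; rewrite -dotj w0 ?mxE//.
by apply/mapP; exists j; rewrite ?mem_enum.
Qed.

End Dot.

(** * Convex sets, rays and chords *)

Section Convexity.
Variables (R : realType) (V : lmodType R).
Implicit Types (A : set V) (x y : V) (t : R).

Lemma convex_setP A : convex_set A <->
  forall x y t, A x -> A y -> 0 <= t <= 1 -> A (t *: x + (1 - t) *: y).
Proof.
split=> [cA x y t Ax Ay /andP[t0 t1]|cA x y l].
  have t01 : Itv.spec (@Itv.num_sem R) (Itv.Real `[0%Z, 1%Z]) t.
    by apply/andP; split; [exact: ger0_real | rewrite /= in_itv/= t0 t1].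
  exact/set_mem/(cA x y (Itv.mk t01))/mem_set/Ay/mem_set.
rewrite !inE => Ax Ay; apply: cA => //; apply/andP; split=> //.
Qed.

(* Weaker than membership in the interior, and stable under adding elements of
   a cone. *)
Definition absorbing_at A x : Prop :=
  forall v, exists2 e : R, 0 < e & A (x + e *: v).

(** The form of boundedness used in Minkowski's theorem; for the polar of [C] it follows directly
    from [absorbing_at C 0]. *)
Definition no_ray A : Prop :=
  forall x v, (forall s, 0 <= s -> A (x + s *: v)) -> v = 0.

Lemma convex_ray_shrink A x v s t : convex_set A ->
  A x -> A (x + s *: v) -> 0 <= t <= s -> A (x + t *: v).
Proof.
move=> /convex_setP cA Ax Axs /andP[t0 ts].
have [s0|s0] := eqVneq s 0.
  have -> : t = 0 by lra.
  by rewrite scale0r addr0.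
have sgt0 : 0 < s by lra.
have -> : x + t *: v = (t / s) *: (x + s *: v) + (1 - t / s) *: x.
  by rewrite scalerDr scalerA divfK// scalerBl scale1r [RHS]addrC addrA subrK.
by apply: cA => //; rewrite divr_ge0 ?ler_pdivrMr ?mul1r ?(ltW sgt0).
Qed.

End Convexity.

Section Topology.
Variables (R : realType) (V : normedModType R).
Implicit Types (A : set V).

Lemma interior_absorbing A x : A° x -> absorbing_at A x.
Proof.
move=> /nbhs_ballP[e /= e0 eA] v.
pose d := e / (2 * (1 + `|v|)).
have v0 := normr_ge0 v.
have d0 : 0 < d by rewrite divr_gt0// mulr_gt0//; lra.
exists d => //; apply: eA.
rewrite -ball_normE /= opprD addrA subrr sub0r normrN.
by rewrite normrZ gtr0_norm// /d mulrAC ltr_pdivrMr; [nra | lra].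
Qed.

Lemma bounded_no_ray A : bounded_set A -> no_ray A.
Proof.
move=> [N [_ /(_ (N + 1)) AM]] x v Axv.
have {}AM y : A y -> `|y| <= N + 1 by apply: AM; rewrite ltrDl.
set M := N + 1 in AM.
apply/eqP; apply: contraT => v0.
have nv : 0 < `|v| by rewrite normr_gt0.
have Ax : A x by have := Axv 0 (lexx 0); rewrite scale0r addr0.
have := AM _ Ax => /= xM.
have nx := normr_ge0 x.
pose s := (M + `|x| + 1) / `|v|.
have s0 : 0 <= s by apply: divr_ge0; lra.
have /= := AM _ (Axv s s0).
have : `|s *: v| <= `|x + s *: v| + `|x|.
  by rewrite -{1}(addrK x (s *: v)) (addrC _ x) ler_normB.
rewrite normrZ ger0_norm// divfK ?gt_eqF//; lra.
Qed.

(** The admissible parameters form a closed set; were it unbounded, convexity would put the whole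
    ray in [A]. The end is its supremum. *)
Lemma closed_ray_end A x v : closed A -> convex_set A -> no_ray A ->
  A x -> v != 0 ->
  exists s, [/\ 0 <= s, A (x + s *: v) & forall r, A (x + r *: v) -> r <= s].
Proof.
move=> clA cA nrA Ax v0.
pose E := [set r : R | 0 <= r /\ A (x + r *: v)].
have E0 : E 0 by split=> //; rewrite scale0r addr0.
have [b Eb] : has_ubound E.
  apply: contrapT => nubE; move/eqP: v0; apply; apply: (nrA x) => s s0.
  apply: contrapT => nAs; apply: nubE; exists s => r [r0 Ar].
  rewrite leNgt; apply/negP => sr; apply: nAs.
  by apply: (convex_ray_shrink cA Ax Ar); rewrite s0 ltW.
have ubE : has_ubound E by exists b.
have clE : closed E.
  apply: closedI; first exact: closed_ge.
  apply: (@preimage_closed _ _ (fun r : R => x + r *: v) A) => // r _.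
  apply: cvgD; first exact: cvg_cst.
  by apply: cvgZr_tmp; exact: cvg_id.
have [s0 As] : E (sup E) by apply: clE; apply: closure_sup => //; exists 0.
exists (sup E); split=> // r Ar.
have [r0|r0] := leP 0 r; first exact: ub_le_sup.
exact: le_trans (ltW r0) s0.
Qed.

End Topology.

(** * Minkowski's theorem and the bipolar theorem *)

Section Minkowski.
Variables (R : realType) (n : nat).
Implicit Types (C D : set 'rV[R]_n) (x v w : 'rV[R]_n).

(** For convex [C] and [x] in [C], this is the direction space of the smallest face of [C]
    containing [x]. *)
Definition two_sided C x : set 'rV[R]_n :=
  [set w | exists2 e : R, 0 < e & C (x + e *: w) /\ C (x - e *: w)].

Lemma two_sided_subspace C x :
  convex_set C -> C x -> linear_subspace (two_sided C x).
Proof.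
move=> cC Cx; have /convex_setP cvxC := cC; split.
- by exists 1; rewrite ?scaler0 ?subr0 ?addr0.
- move=> v w [e e0 [vp vm]] [d d0 [wp wm]].
  pose c := Num.min e d.
  have c0 : 0 < c by rewrite lt_min e0.
  have ce : 0 <= c <= e by rewrite ltW//= ge_min lexx.
  have cd : 0 <= c <= d by rewrite ltW//= ge_min lexx orbT.
  have mid (a b : 'rV[R]_n) : C (x + c *: a) -> C (x + c *: b) ->
      C (x + (c / 2) *: (a + b)).
    move=> Ca Cb; have := cvxC _ _ (1 / 2) Ca Cb.
    have -> : (1 / 2) *: (x + c *: a) + (1 - 1 / 2) *: (x + c *: b) =
        x + (c / 2) *: (a + b) by apply/rowP => i; rewrite !mxE; field.
    by apply; lra.
  exists (c / 2); first by rewrite divr_gt0.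
  split.
    apply: mid; first exact: convex_ray_shrink vp ce.
    exact: convex_ray_shrink wp cd.
  rewrite -scalerN opprD; apply: mid.
    by apply: (convex_ray_shrink cC Cx _ ce); rewrite scalerN.
  by apply: (convex_ray_shrink cC Cx _ cd); rewrite scalerN.
- move=> t v [e e0 [vp vm]].
  have [->|t0] := eqVneq t 0.
    by exists 1; rewrite ?scale0r ?scaler0 ?subr0 ?addr0.
  have nt : 0 < `|t| by rewrite normr_gt0.
  exists (e / `|t|); first exact: divr_gt0.
  rewrite scalerA; have [tp|tn] := leP 0 t.
    by rewrite ger0_norm ?divfK.
  by rewrite ltr0_norm// invrN mulrN mulNr divfK// scaleNr opprK.
Qed.

Lemma two_sided0_ext C x : convex_set C -> C x ->
  (forall w, two_sided C x w -> w = 0) -> ext C x.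
Proof.
move=> /convex_setP cC Cx x0; split=> // a b t Ca Cb /andP[t0 t1] xE.
have ab : a = b.
  apply/eqP; rewrite -subr_eq0; apply/eqP/x0.
  (* With this step size the coefficient of [a] becomes [t ± t(1 - t)], which stays in [[0, 1]]. *)
  exists (t * (1 - t)); first by nra.
  split; rewrite xE.
    have -> : t *: a + (1 - t) *: b + (t * (1 - t)) *: (a - b) =
        (t + t * (1 - t)) *: a + (1 - (t + t * (1 - t))) *: b.
      by apply/rowP => i; rewrite !mxE; ring.
    by apply: cC => //; nra.
  have -> : t *: a + (1 - t) *: b - (t * (1 - t)) *: (a - b) =
      (t - t * (1 - t)) *: a + (1 - (t - t * (1 - t))) *: b.
    by apply/rowP => i; rewrite !mxE; ring.
  by apply: cC => //; nra.
by move: xE; rewrite ab -scalerDl addrC subrK scale1r => ->.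
Qed.

(** The homothety of centre [x - e v] and ratio [e / (s + e)] maps [x + s v] to [x], and a segment
    of [C] around the former to one around the latter. *)
Lemma two_sided_chord C x v s e : convex_set C ->
  C (x - e *: v) -> 0 < e -> 0 < s ->
  two_sided C (x + s *: v) `<=` two_sided C x.
Proof.
move=> /convex_setP cC Ce e0 s0 u [d d0 [dp dm]].
have se : s + e != 0 by rewrite gt_eqF//; lra.
have l01 : 0 <= e / (s + e) <= 1.
  by rewrite divr_ge0/= ?ler_pdivrMr; lra.
exists (e / (s + e) * d); first by rewrite mulr_gt0// divr_gt0//; lra.
split.
  have -> : x + (e / (s + e) * d) *: u =
    (e / (s + e)) *: (x + s *: v + d *: u) + (1 - e / (s + e)) *: (x - e *: v).
    by apply/rowP => i; rewrite !mxE; field.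
  exact: cC.
have -> : x - (e / (s + e) * d) *: u =
  (e / (s + e)) *: (x + s *: v - d *: u) + (1 - e / (s + e)) *: (x - e *: v).
  by apply/rowP => i; rewrite !mxE; field.
exact: cC.
Qed.

(* Induction on the dimension of the face of C around x: unless x is extreme,
   it lies between the two ends of a chord of C, whose faces are smaller. *)
Lemma minkowski_ext C D : closed C -> convex_set C -> no_ray C ->
  convex_set D -> ext C `<=` D -> C `<=` D.
Proof.
move=> clC cC nrC /convex_setP cD extD x Cx.
have [A xA] := linear_subspace_rowspace (two_sided_subspace cC Cx).
have [k] := ubnP (\rank A); elim: k => // k IH in x Cx A xA *.
rewrite ltnS => rkA.
have [x0|] := pselect (forall w, two_sided C x w -> w = 0).
  by apply/extD/two_sided0_ext.
move=> /existsNP[w /not_implyP[xw /eqP w0]].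
have IHend v s : two_sided C x v -> v != 0 -> C (x + s *: v) -> 0 < s ->
    (forall r, C (x + r *: v) -> r <= s) -> D (x + s *: v).
  move=> xv v0 Cs s0 maxs.
  have [B sB] := linear_subspace_rowspace (two_sided_subspace cC Cs).
  apply: (IH _ Cs B sB); apply: leq_trans rkA; apply: rank_ltmx.
  have [e e0 [ep em]] := xv.
  rewrite ltmxE; apply/andP; split.
    apply/row_subP => i; apply/xA; apply: (two_sided_chord cC em e0 s0).
    by apply/sB; exact: row_sub.
  (* The inclusion is strict: [v] is two-sided at [x], but not at [x + s v], where the chord
     ends. *)
  apply/negP => AB.
  have /sB[d d0 [+ _]] : (v <= B)%MS by apply: submx_trans AB; exact/xA.
  by rewrite -addrA -scalerDl => /maxs; lra.
have wm : two_sided C x (- w).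
  by case: xw => e e0 [wp wm]; exists e; rewrite // !scalerN opprK.
have [s [s0 Cs maxs]] := closed_ray_end clC cC nrC Cx w0.
have [|r [r0 Cr maxr]] := closed_ray_end (v := - w) clC cC nrC Cx.
  by rewrite oppr_eq0.
have [e e0 [ep em]] := xw.
have es := maxs _ ep.
have er : e <= r by apply: maxr; rewrite scalerN.
have Ds : D (x + s *: w) by apply: IHend => //; lra.
have Dr : D (x + r *: - w) by apply: IHend; rewrite ?oppr_eq0//; lra.
have sr : s + r != 0 by rewrite gt_eqF//; lra.
have -> : x = (r / (s + r)) *: (x + s *: w) +
    (1 - r / (s + r)) *: (x + r *: - w).
  by apply/rowP => i; rewrite !mxE; field.
apply: cD => //; apply/andP; split; first by apply: divr_ge0; lra.
by rewrite ler_pdivrMr; lra.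
Qed.
End Minkowski.

(** * Separation and properties of the polar *)

Section Separation.
Variables (R : realType) (n : nat).
Implicit Types (C : set 'rV[R]_n) (x y v w : 'rV[R]_n).

(** If [x] differs from its nearest point [p] in [C], then [u = x - p] is an outer normal at [p],
    and [u / <p, u>] is a point of the polar that violates the hypothesis on [x]. *)
Lemma bipolar C x : compact C -> convex_set C -> absorbing_at C 0 ->
  (forall y, polar C y -> dot x y <= 1) -> C x.
Proof.
move=> kC /convex_setP cC C0 xC.
have C00 : C 0 by have [e _] := C0 0; rewrite scaler0 addr0.
have [||p pC pmin] := compact_EVT_min (f := fun y => dot (x - y) (x - y)) _ kC.
- by exists 0.
- by apply: continuous_subspaceT; exact: continuous_dist2.
rewrite inE in pC; have [->//|xp] := eqVneq x p.
have [u uE] : exists u, u = x - p by exists (x - p).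
have u0 : u != 0 by rewrite uE subr_eq0.
have sep c : C c -> dot (c - p) u <= 0.
  move=> Cc; have [d dE] : exists d, d = c - p by exists (c - p).
  rewrite -dE leNgt; apply/negP => du.
  (* The distance from [x] is least at [t = <d, u> / <d, d>]; the larger denominator ensures
     [t <= 1] and still decreases the distance. *)
  pose t := dot d u / (dot d u + dot d d).
  have dd := dot_ge0 d.
  have t0 : 0 < t by rewrite divr_gt0//; lra.
  have tE : t * (dot d u + dot d d) = dot d u by rewrite divfK// gt_eqF//; lra.
  have t1 : t <= 1 by nra.
  have /mem_set/pmin : C (t *: c + (1 - t) *: p) by apply: cC => //; lra.
  have -> : x - (t *: c + (1 - t) *: p) = u - t *: d.
    by rewrite uE dE; apply/rowP => i; rewrite !mxE; ring.
  rewrite -uE !dot_lin (dotC u d); nra.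
have upos := dot_gt0 u0.
have pu : 0 < dot p u.
  have [e e0] := C0 u; rewrite add0r => /sep; rewrite !dot_lin; nra.
have : polar C ((dot p u)^-1 *: u).
  move=> c /sep; rewrite !dot_lin subr_le0 => cp.
  by rewrite mulrC ler_pdivrMr// mul1r.
move=> /xC; rewrite !dot_lin mulrC ler_pdivrMr// mul1r.
by rewrite -[x](subrK p) -uE !dot_lin; lra.
Qed.

Lemma polar_closed C : closed (polar C).
Proof.
have -> : polar C = \bigcap_(x in C) (dot x @^-1` [set r | r <= 1]) by [].
apply: closed_bigI => x _.
apply: (@preimage_closed _ _ (dot x) [set r | r <= 1]) => [y _|].
  exact: continuous_dot.
exact: closed_le.
Qed.

Lemma polar_convex C : convex_set (polar C).
Proof.
apply/convex_setP => y z t yC zC /andP[t0 t1] x Cx; rewrite !dot_lin.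
have := yC x Cx; have := zC x Cx; nra.
Qed.

Lemma polar_no_ray C : absorbing_at C 0 -> no_ray (polar C).
Proof.
move=> C0 y v yv; apply/eqP; apply: contraT => /dot_gt0 v0.
have [e e0] := C0 v; rewrite add0r => Cv.
(* Chosen so that [e v], a point of [C], pairs with [y + s v] to at least 2. *)
pose s := (2 + `|e * dot v y|) / (e * dot v v).
have ev : 0 < e * dot v v by rewrite mulr_gt0.
have s0 : 0 <= s by rewrite divr_ge0 ?(ltW ev)// addr_ge0.
have := yv s s0 _ Cv; rewrite !dot_lin.
have -> : e * (s * dot v v) = 2 + `|e * dot v y|.
  by rewrite mulrCA /s divfK// gt_eqF.
by have := ler_norm (- (e * dot v y)); rewrite normrN; lra.
Qed.

End Separation.

(** * Extension of nonnegative functionals *)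

Section RieszExtension.
Variables (R : realType) (m : nat) (K : set 'rV[R]_m).
Hypothesis K_cone : convex_cone K.
Implicit Types (L M : set 'rV[R]_m) (e u v w z : 'rV[R]_m).

Lemma convex_coneZ t w : 0 <= t -> K w -> K (t *: w).
Proof. by have [_ _] := K_cone; apply. Qed.

Lemma convex_coneD v w : K v -> K w -> K (v + w).
Proof.
have [_ /convex_setP cK _] := K_cone; move=> Kv Kw.
have -> : v + w = 2 *: ((1 / 2) *: v + (1 - 1 / 2) *: w).
  by apply/rowP => i; rewrite !mxE; field.
by apply: convex_coneZ => //; apply: cK => //; lra.
Qed.

(** Positivity passes from the hyperplane [<w, u> = 0] of [M] to all of [M]. The constant [c] must
    lie above [- <w, z>] on the slice [<w, u> = 1] of the cone and below [<w, z>] on the slice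
    [<w, u> = -1]; a supremum provides it. *)
Lemma riesz_step M e u z : absorbing_at K e -> linear_subspace M -> M e ->
  dot e u = 0 ->
  (forall w, K w -> M w -> dot w u = 0 -> 0 <= dot w z) ->
  exists c, forall w, K w -> M w -> 0 <= dot w (z + c *: u).
Proof.
move=> eK [M0 MD MZ] Me eu posz.
have [u0|/existsNP[v /not_implyP[Mv /eqP vu]]] :=
  pselect (forall v, M v -> dot v u = 0).
  by exists 0 => w Kw Mw; rewrite scale0r addr0; apply: posz => //; exact: u0.
(* Both slices are nonempty: move from [e] along [v], staying in [K], and rescale. *)
have norm1 s : s != 0 -> exists w, [/\ K w, M w & dot w u = s].
  move=> s0; have [d d0 Kd] := eK ((s / dot v u) *: v).
  exists (d^-1 *: (e + d *: ((s / dot v u) *: v))); split.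
  - by apply: convex_coneZ => //; rewrite invr_ge0 ltW.
  - by apply/MZ/MD => //; exact/MZ/MZ.
  - by rewrite !dot_lin eu add0r divfK// mulKf// gt_eqF.
pose S := [set r | exists w, [/\ K w, M w, dot w u = 1 & r = - dot w z]].
have ubS w : K w -> M w -> dot w u = -1 -> ubound S (dot w z).
  move=> Kw Mw wu _ [v' [Kv' Mv' vu' ->]].
  (* The sum of points of opposite slices lies in the hyperplane, where [z] is nonnegative. *)
  rewrite -subr_ge0 opprK -dotDl; apply: posz.
  - exact: convex_coneD.
  - exact: MD.
  - by rewrite dotDl wu vu' addNr.
have S0 : S !=set0.
  by have [w [Kw Mw wu]] := norm1 1 (oner_neq0 _); exists (- dot w z), w.
have hubS : has_ubound S.
  have [|w [Kw Mw wu]] := norm1 (-1); first by rewrite oppr_eq0 oner_eq0.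
  by exists (dot w z); exact: ubS.
exists (sup S) => w Kw Mw; rewrite !dot_lin.
have [wu|wu|wu] := ltgtP (dot w u) 0; last first.
- by rewrite wu mulr0 addr0; exact: posz.
- have : - dot ((dot w u)^-1 *: w) z <= sup S.
    apply: ub_le_sup => //; exists ((dot w u)^-1 *: w); split=> //.
    + by apply: convex_coneZ; rewrite // invr_ge0 ltW.
    + exact: MZ.
    + by rewrite dotZl mulVf// gt_eqF.
  rewrite dotZl -mulrN mulrC ler_pdivrMr//; lra.
- have : sup S <= dot ((- dot w u)^-1 *: w) z.
    apply: ge_sup => //; apply: ubS.
    + by apply: convex_coneZ; rewrite // invr_ge0; lra.
    + exact: MZ.
    + by rewrite dotZl invrN mulNr mulVf// lt_eqF.
  rewrite dotZl mulrC ler_pdivlMr; lra.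
Qed.

(** The equations are dropped one at a time; each step adds to [z] a multiple of some [u] in [us],
    which changes nothing on the common kernel. *)
Lemma riesz_extension_orth e (us : seq 'rV[R]_m) z : absorbing_at K e ->
  {in us, forall u, dot e u = 0} ->
  (forall w, K w -> {in us, forall u, dot w u = 0} -> 0 <= dot w z) ->
  exists2 z', dual_cone K z' &
    forall w, {in us, forall u, dot w u = 0} -> dot w z' = dot w z.
Proof.
move=> eK; elim: us z => [|u us IH] z eus posz.
  by exists z => // w Kw; apply: posz.
pose M := [set w | {in us, forall u, dot w u = 0}].
have subM : linear_subspace M.
  split=> [u' _|v w Mv Mw u' uus|t w Mw u' uus]; rewrite dot_lin //.
    by rewrite Mv ?Mw ?addr0.
  by rewrite Mw ?mulr0.
have Me : M e by move=> u' uus; apply: eus; rewrite inE uus orbT.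
have [||c posc] := @riesz_step M e u z eK subM Me.
- by apply: eus; exact: mem_head.
- move=> w Kw Mw wu; apply: posz => // u'; rewrite inE => /predU1P[->//|].
  exact: Mw.
have [z' Kz' z'E] := IH _ Me posc.
exists z' => // w wus.
rewrite z'E; last by move=> u' uus; apply: wus; rewrite inE uus orbT.
by rewrite !dot_lin (wus u) ?mulr0 ?addr0 ?mem_head.
Qed.

Lemma riesz_extension M e z : absorbing_at K e -> linear_subspace M -> M e ->
  (forall w, K w -> M w -> 0 <= dot w z) ->
  exists2 z', dual_cone K z' & forall w, M w -> dot w z' = dot w z.
Proof.
move=> eK /linear_subspace_orth[us Mus] /Mus eus posz.
have [|z' Kz' z'E] := riesz_extension_orth eK eus (z := z).
  by move=> w Kw /Mus; exact: posz.
by exists z' => // w /Mus; exact: z'E.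
Qed.

End RieszExtension.

(** * From proper lifts to factorizations *)

Section Duality.
Variables (R : realType) (m n : nat).
Implicit Types (K L : set 'rV[R]_m) (C : set 'rV[R]_n).

Lemma affine_direction L l : affine_subspace L -> L l ->
  linear_subspace [set d | L (l + d)].
Proof.
move=> [_ aL] Ll.
have LZ (t : R) d : L (l + d) -> L (l + t *: d).
  move=> Ld; have -> : l + t *: d = t *: (l + d) + (1 - t) *: l.
    by apply/rowP => i; rewrite !mxE; ring.
  exact: aL.
split=> [|d d' Ld Ld'|t d]; rewrite /= ?addr0//; last exact: LZ.
(* The sum of two directions is twice their midpoint. *)
have -> : l + (d + d') =
    l + 2 *: ((1 / 2) *: (l + d) + (1 - 1 / 2) *: (l + d') - l).
  by apply/rowP => i; rewrite !mxE; field.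
apply: LZ; rewrite addrC subrK; exact: aL.
Qed.

(* A direction of L interior to K would make every direction of L a recession
   direction of K /\ L, so that C would reduce to a point. *)
Lemma proper_lift_pointed K C L pi l d : (0 < n)%N -> convex_cone K ->
  no_ray C -> absorbing_at C 0 -> is_lift K C L pi -> K l -> L l ->
  L (l + d) -> ~ absorbing_at K d.
Proof.
move=> n0 K_cone nrC C0 [aL CE] Kl Ll Ld dK.
have [_ LD LZ] := affine_direction aL Ll.
have pi0K v : L (l + v) -> K v -> pi v = 0.
  move=> Lv Kv; apply: (nrC (pi l)) => s s0.
  rewrite -linearZ -linearD CE; exists (l + s *: v) => //; split.
    by apply: convex_coneD => //; exact: convex_coneZ.
  exact: LZ.
have pid : pi d = 0.
  by apply: pi0K => //; have [e _] := dK 0; rewrite scaler0 addr0.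
have pi0 v : L (l + v) -> pi v = 0.
  move=> Lv; have [e e0 Ke] := dK v.
  have /eqP : pi (d + e *: v) = 0.
    by apply: pi0K => //; apply: LD => //; exact: LZ.
  by rewrite linearD linearZ pid add0r scaler_eq0 gt_eqF//= => /eqP.
have C1 x : C x -> x = pi l.
  rewrite CE => -[w [_ Lw] <-].
  have wE : w = l + (w - l) by rewrite addrC subrK.
  by rewrite wE linearD (pi0 (w - l)) ?addr0 -?wE.
(* Now [C] is reduced to 0, yet it contains a positive multiple of the all-ones vector, nonzero
   since [0 < n]. *)
have [e' _] := C0 0; rewrite scaler0 addr0 => /C1 pil.
have [e e0] := C0 (const_mx 1); rewrite add0r => /C1; rewrite -pil.
by move=> /rowP/(_ (Ordinal n0))/eqP; rewrite !mxE mulr1 gt_eqF.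
Qed.

Lemma proper_lift_dual K C L pi l y : (0 < n)%N -> convex_cone K ->
  no_ray C -> absorbing_at C 0 -> is_lift K C L pi ->
  absorbing_at K l -> L l -> polar C y ->
  exists2 z, dual_cone K z & forall w, L w -> dot w z = 1 - dot (pi w) y.
Proof.
move=> n0 K_cone nrC C0 lift lK Ll yC; have [aL CE] := lift.
have Kl : K l by have [e _] := lK 0; rewrite scaler0 addr0.
have subL := affine_direction aL Ll; have [L0 LD LZ] := subL.
set L' := [set d | L (l + d)] in subL.
have npt := proper_lift_pointed n0 K_cone nrC C0 lift Kl Ll.
have nLl : ~ L' l by move=> /npt.
have [us usE] := linear_subspace_orth subL.
have [v vus lv] : exists2 v, v \in us & dot l v != 0.
  apply: contrapT => nv; apply/nLl/usE => u uus; apply/eqP/negPn/negP => lu.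
  by apply: nv; exists u.
pose u := (dot l v)^-1 *: v.
have lu : dot l u = 1 by rewrite dotZr mulVf.
have L'u d : L' d -> dot d u = 0.
  by move=> /usE/(_ v vus); rewrite dotZr => ->; rewrite mulr0.
(* This is the linear span of [L]: the functional [u] is 1 on [L] and gives the coefficient of
   [l]. *)
pose M := [set w | L' (w - dot w u *: l)].
have subM : linear_subspace M.
  split=> [|w w' Mw Mw'|t w Mw]; rewrite /M /=.
  - by rewrite dot0l scale0r subr0.
  - by rewrite dotDl scalerDl opprD addrACA; exact: LD.
  - by rewrite dotZl -scalerA -scalerBr; exact: LZ.
have Ml : M l by rewrite /M /= lu scale1r subrr.
pose z := u - y *m (lin1_mx pi)^T.
have dotz w : dot w z = dot w u - dot (pi w) y.
  rewrite /z dotDr dotNr; congr (_ - _).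
  by rewrite !dotE trmx_mul trmxK mulmxA mul_rV_lin1.
have posz w : K w -> M w -> 0 <= dot w z.
  move=> Kw; rewrite dotz /M /= => Mw; set t := dot w u in Mw *.
  set d := w - t *: l in Mw.
  have wE : w = d + t *: l by rewrite subrK.
  (* If [t < 0], then [d / (-t) = w / (-t) + l] is a direction of [L] interior to [K], which is
     excluded. If [t > 0], then [w / t] is in the lift and the polar inequality applies. If [t = 0],
     then [w] is a recession direction of the lift, so [pi w = 0]. *)
  have [t0|t0|t0] := ltgtP t 0.
  - exfalso; apply: (npt ((- t)^-1 *: d)); first exact: LZ.
    move=> v'; have [e e0 Ke] := lK v'; exists e => //.
    have -> : (- t)^-1 *: d + e *: v' = (- t)^-1 *: w + (l + e *: v').
      rewrite wE; apply/rowP => i; rewrite !mxE; field.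
      by rewrite lt_eqF.
    by apply: convex_coneD => //; apply: convex_coneZ; rewrite // invr_ge0; lra.
  - have : C (pi (t^-1 *: w)).
      rewrite CE; exists (t^-1 *: w) => //; split.
        by apply: convex_coneZ; rewrite // invr_ge0 ltW.
      have -> : t^-1 *: w = l + t^-1 *: d.
        rewrite wE; apply/rowP => i; rewrite !mxE; field.
        by rewrite gt_eqF.
      exact: LZ.
    by move=> /yC; rewrite linearZ dotZl mulrC ler_pdivrMr// mul1r; lra.
  - suff -> : pi w = 0 by rewrite dot0l subr0 ?t0.
    apply: (nrC (pi l)) => s s0.
    rewrite -linearZ -linearD CE; exists (l + s *: w) => //; split.
      by apply: convex_coneD => //; exact: convex_coneZ.
    by apply: LZ; move: Mw; rewrite /d t0 scale0r subr0.
have [z' Kz' z'E] := riesz_extension K_cone lK subM Ml posz.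
exists z' => // w Lw.
have Lwl : L' (w - l) by rewrite /L' /= addrC subrK.
have wu : dot w u = 1 by rewrite -[w](subrK l) dotDl L'u// add0r.
by rewrite z'E ?dotz ?wu// /M /= wu scale1r.
Qed.

Lemma proper_lift_factorizable K C : (0 < n)%N -> convex_cone K ->
  convex_body C -> has_proper_lift K C -> factorizable K C.
Proof.
move=> n0 K_cone [kC _ iC] [L [pi [lift [l [Ll iK]]]]]; have [_ CE] := lift.
have nrC := bounded_no_ray (compact_bounded kC).
have /choice[A AP] (x : ext C) : exists a : K, L (val a) /\ pi (val a) = val x.
  have [+ _] := set_valP x.
  rewrite {1}CE => -[w [Kw Lw] wx].
  by exists (SigSub (mem_set Kw)).
have /choice[B BP] (y : ext (polar C)) : exists b : dual_cone K,
    forall w, L w -> dot w (val b) = 1 - dot (pi w) (val y).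
  have [yC _] := set_valP y.
  have [z Kz zE] := proper_lift_dual n0 K_cone nrC (interior_absorbing iC) lift
    (interior_absorbing iK) Ll yC.
  by exists (SigSub (mem_set Kz)).
exists A, B => x y; have [LA piA] := AP x.
by rewrite BP// piA.
Qed.

End Duality.

(** * From factorizations to lifts *)

Section Factorization.
Variables (R : realType) (m n : nat).
Variables (K : set 'rV[R]_m) (C : set 'rV[R]_n).
Hypotheses (K_cone : convex_cone K) (C_body : convex_body C).

Lemma body_absorbing : absorbing_at C 0.
Proof. by have [_ _] := C_body; exact: interior_absorbing. Qed.

Lemma sub_convex_of_ext (D : set 'rV[R]_n) :
  convex_set D -> ext C `<=` D -> C `<=` D.
Proof.
have [kC cC _] := C_body; apply: minkowski_ext => //.
  exact: compact_closed kC.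
exact/bounded_no_ray/compact_bounded.
Qed.

Lemma polar_le_of_ext x r : (forall y : ext (polar C), dot x (val y) <= r) ->
  forall y, polar C y -> dot x y <= r.
Proof.
move=> xr.
apply: (@minkowski_ext _ _ (polar C) [set y | dot x y <= r]).
- exact: polar_closed.
- exact: polar_convex.
- exact/polar_no_ray/body_absorbing.
- by apply/convex_setP => y z t /= yr zr /andP[t0 t1]; rewrite !dot_lin; nra.
- by move=> y ey; exact: (xr (SigSub (mem_set ey))).
Qed.

(** By Minkowski's theorem the constancy extends to the whole polar, which contains 0; so [t = 0],
    and by the bipolar theorem the ray through [x] lies in the bounded set [C]. *)
Lemma dot_ext_polar_const x t :
  (forall y : ext (polar C), dot x (val y) = t) -> x = 0.
Proof.
move=> xt.
have p0 : polar C 0 by move=> z _; rewrite dot0r ler01.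
have xE y : polar C y -> dot x y = t.
  move=> yC; apply/eqP; rewrite eq_le; apply/andP; split.
    by apply: polar_le_of_ext yC => y'; rewrite xt.
  rewrite -lerN2 -dotNl.
  by apply: polar_le_of_ext yC => y'; rewrite dotNl xt.
have t0 : t = 0 by rewrite -(xE 0 p0) dot0r.
have [kC cC _] := C_body.
apply: (bounded_no_ray (compact_bounded kC) (x := 0)) => s _.
apply: (bipolar kC cC body_absorbing) => y yC.
by rewrite add0r dotZl xE// t0 mulr0.
Qed.

Lemma factorizable_lift : factorizable K C -> has_lift K C.
Proof.
move=> [A [B AB]].
(* Replacing the constant 1 of the slack by a free scalar [t] homogenizes the relation, which makes
   it a linear subspace. *)
pose G z x := exists t, forall y : ext (polar C),
  t - dot x (val y) = dot z (val (B y)).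
have [||pi piE] := @linear_graph_extension R m n G.
- split=> [|w w' [t wt] [t' wt']|s w [t wt]].
  + by exists 0 => y; rewrite /= !linear0 !dot0l subrr.
  + by exists (t + t') => y; rewrite /= !linearD !dotDl -wt -wt'; ring.
  + by exists (s * t) => y; rewrite /= !linearZ !dotZl -wt; ring.
- move=> x [t xt]; apply: (@dot_ext_polar_const x t) => y.
  by apply/esym/eqP; rewrite -subr_eq0 xt dot0l.
pose S x z := forall y : ext (polar C), 1 - dot x (val y) = dot z (val (B y)).
have Spi x z : S x z -> pi z = x by move=> xz; apply: piE; exists 1.
have Saff x z x' z' t : S x z -> S x' z' ->
    S (t *: x + (1 - t) *: x') (t *: z + (1 - t) *: z').
  by move=> xz xz' y; rewrite !dot_lin -xz -xz'; ring.
pose L := [set z | exists x, S x z].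
have CA (x : ext C) : S (val x) (val (A x)) by move=> y; rewrite -AB.
have subC : C `<=` pi @` (K `&` L).
  apply: sub_convex_of_ext => [|x ex].
    apply/convex_setP => _ _ t [z [Kz [x zx]] <-] [z' [Kz' [x' zx']] <-] t01.
    exists (t *: z + (1 - t) *: z'); last by rewrite linearD !linearZ.
    split; last by exists (t *: x + (1 - t) *: x'); exact: Saff.
    have [_ /convex_setP cK _] := K_cone; exact: cK.
  have Ax := CA (SigSub (mem_set ex)).
  exists (val (A (SigSub (mem_set ex)))); last exact: Spi Ax.
  by split; [exact: set_valP | exists x].
exists L, pi; split; first split.
- have [|z [_ Lz] _] := subC 0; last by exists z.
  by have [_ _ /interior_subset] := C_body.
- move=> z z' t [x zx] [x' zx']; exists (t *: x + (1 - t) *: x'); exact: Saff.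
apply/seteqP; split=> // _ [z [Kz [x zx]] <-]; rewrite (Spi _ _ zx).
have [kC cC _] := C_body.
(* At an extreme point [y], the slack of [x] equals [<z, B y>], nonnegative by duality. *)
apply: (bipolar kC cC body_absorbing); apply: polar_le_of_ext => y.
by have := set_valP (B y) z Kz; rewrite -zx; lra.
Qed.

End Factorization.

Theorem theorem2p4 (R : realType) (m n : nat) (n_gt0 : (0 < n)%N)
    (K : set 'rV[R]_m) (K_cone : convex_cone K) (K_closed : closed K)
    (K_full : full_dimensional K)
    (C : set 'rV[R]_n) (C_body : convex_body C) :
  (has_proper_lift K C -> factorizable K C) /\
  (factorizable K C -> has_lift K C).
Proof.
split; first exact: proper_lift_factorizable.
exact: factorizable_lift.
Qed.
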